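(* Let $L_n$ be the largest half-length of a cycle in a uniformly distributed random meander system on $2n$ points. Then, for all sufficiently large $n$, $$\mathbb{E} L_n \geq 0.8384 \log_2 n.$$
   Context: A pairing of $[2n]=\{1,\ldots,2n\}$ (a partition into $n$ pairs) is non-crossing if there are no $\alpha<\beta<\gamma<\delta$ such that $\alpha$ is paired with $\gamma$ and $\beta$ with $\delta$. A meander system on $2n$ points (of half-length $n$) is a pair $M=(P_1,P_2)$ of non-crossing pairings of $[2n]$; $P_1$ (upper) is drawn by non-intersecting arcs in the upper half-plane and $P_2$ (lower) in the lower half-plane, connecting the points $(1,0),\ldots,(2n,0)$. Its cycles are the connected components of the resulting union of curves; equivalently, the connected components of the multigraph on $[2n]$ with edge set $P_1\sqcup P_2$. The support of a cycle is the set of points of $[2n]$ it contains; it has even size $2k$, and $k$ is called the half-length of the cycle. A uniformly distributed random meander system has its upper and lower pairings chosen independently and uniformly among all non-crossing pairings of $[2n]$. *)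

(* Defs.v *)
From mathcomp Require Import all_boot all_order all_algebra.
From mathcomp Require Import reals exp.

Set Implicit Arguments.
Unset Strict Implicit.
Unset Printing Implicit Defensive.

Import Order.TTheory GRing.Theory Num.Theory.

Local Open Scope ring_scope.

Section Meanders.
Variable n : nat.

(* The points 1, ..., 2n are numbered 0, ..., 2n - 1. *)
Definition point := 'I_(2 * n).

Definition is_pairing (P : {set {set point}}) : bool :=
  partition P [set: point] && [forall B in P, #|B| == 2%N].

Definition paired (P : {set {set point}}) : rel point :=
  [rel x y | (x != y) && ([set x; y] \in P)].

Definition noncrossing (P : {set {set point}}) : bool :=
  ~~ [exists a : point, exists b : point, exists c : point, exists d : point,
        [&& (a < b)%N, (b < c)%N, (c < d)%N, paired P a c & paired P b d]].

Definition nc_pairings : {set {set {set point}}} :=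
  [set P | is_pairing P && noncrossing P].

Definition meander_systems : {set {set {set point}} * {set {set point}}} :=
  setX nc_pairings nc_pairings.

(* Double edges of the multigraph do not affect its connected components. *)
Definition edge (M : {set {set point}} * {set {set point}}) : rel point :=
  [rel x y | paired M.1 x y || paired M.2 x y].

Definition cycle_supports (M : {set {set point}} * {set {set point}}) :
    {set {set point}} :=
  equivalence_partition (connect (edge M)) [set: point].

Definition half_length (C : {set point}) : nat := #|C|./2.

Definition largest_half_length
    (M : {set {set point}} * {set {set point}}) : nat :=
  \max_(C in cycle_supports M) half_length C.

End Meanders.

(* Expectation of f under the uniform distribution on a nonempty finite set A. *)
Definition uniform_expectation (R : realType) (T : finType) (A : {set T})
    (f : T -> R) : R :=
  (\sum_(x in A) f x) / #|A|%:R.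

(* Independent uniform upper and lower pairings amount to the uniform
   distribution on the product set [meander_systems n]. *)
Definition expected_largest_half_length (R : realType) (n : nat) : R :=
  uniform_expectation (meander_systems n)
    (fun M => (largest_half_length M)%:R).

Definition log2 (R : realType) (x : R) : R := ln x / ln 2.

(* Main.v *)
(**
Non-crossing pairings are Dyck words. If the upper and the lower word contain, at the same place,
Dyck factors x and y of length 2h whose arcs connect all 2h points, then some cycle has half-length
at least h. A given Dyck factor occurs at a given place in exactly C_(n-h) of the C_n Dyck words of
length 2n, and two given factors at disjoint places in C_(n-2h) of them. So the number of successful
places, among about n/h disjoint ones, has mean at least (n/h) |F| 16^-h, where F is the set of
admissible pairs (x, y), and since C_n C_(n-2h) / C_(n-h)^2 tends to 1 the second moment method
applies.

Many admissible pairs arise from a sweep from left to right which only remembers which dangling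
strand ends belong to the same component. Blocks of 72 points leading from a single strand to a
single strand can be concatenated freely, and a computation exhibits 2^104 of them. With r blocks
this gives h = 36 r + 1 and |F| >= 2^(104 r), hence a mean of order n 2^(-40 r) / r; taking r close
to (log2 n) / 42 gives E L_n >= 0.99 * (36 / 42) * log2 n - O(1), and 0.99 * 36 / 42 > 0.848.
*)
Require Import Defs.
From mathcomp Require Import all_boot all_order all_algebra.
From mathcomp Require Import reals exp.
From mathcomp Require Import zify ring lra.
From Stdlib Require BinNat.

Set Implicit Arguments.
Unset Strict Implicit.
Unset Printing Implicit Defensive.

Import Order.TTheory GRing.Theory Num.Theory.

(** * Dyck words *)

Fixpoint strings (T : Type) (A : seq T) (j : nat) : seq (seq T) :=
  if j is j'.+1 then [seq a :: w | a <- A, w <- strings A j'] else [:: [::]].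

Lemma strings_uniq (T : eqType) (A : seq T) j : uniq A -> uniq (strings A j).
Proof.
move=> uA; elim: j => // j IH.
by apply: allpairs_uniq => // -[m w] [m' w'] _ _ [-> ->].
Qed.

Lemma mem_strings (T : eqType) (A : seq T) j w :
  (w \in strings A j) = (size w == j) && all (mem A) w.
Proof.
elim: j w => [|j IH] [|a w] //; rewrite /strings -/(strings A j).
  by apply/negbTE/negP => /allpairsP [[? ?] []].
apply/allpairsP/idP => [[[b v] [/= bA + [-> ->]]]|].
  by rewrite IH /= eqSS bA.
by case/and3P=> sz aA wA; exists (a, w); split=> //; rewrite IH; apply/andP.
Qed.

Fixpoint walk (h : nat) (w : seq bool) : option nat :=
  match w with
  | [::] => Some h
  | true :: w' => walk h.+1 w'
  | false :: w' => if h is h'.+1 then walk h' w' else None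
  end.

Definition dyck (w : seq bool) : bool := walk 0 w == Some 0.

Lemma walk_cat h u v : walk h (u ++ v) = obind (walk^~ v) (walk h u).
Proof. by elim: u h => [|[] u IH] [|h] //=; rewrite IH. Qed.

Lemma walk_lift j h w k : walk h w = Some k -> walk (j + h) w = Some (j + k).
Proof.
elim: w h => [h [->] //|[] w IH] [|h] //=; rewrite ?addn0 ?addnS //=.
- by move=> /IH; rewrite addn1.
- by move=> /IH; rewrite !addnS.
- by move=> /IH.
Qed.

Lemma walk_dyck h d : dyck d -> walk h d = Some h.
Proof. by move=> /eqP /(walk_lift h); rewrite addn0. Qed.

Lemma walk_remove h a d b : dyck d -> walk h (a ++ d ++ b) = walk h (a ++ b).
Proof.
by move=> Dd; rewrite !walk_cat; case: (walk h a) => //= k; rewrite walk_cat walk_dyck.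
Qed.

Lemma dyck_remove a d b : dyck d -> dyck (a ++ d ++ b) = dyck (a ++ b).
Proof. by move=> Dd; rewrite /dyck walk_remove. Qed.

Lemma dyck_cat u v : dyck u -> dyck v -> dyck (u ++ v).
Proof. by move=> Du Dv; rewrite -(cat0s (u ++ v)) dyck_remove. Qed.

Lemma dyck_arc u : dyck u -> dyck (true :: u ++ [:: false]).
Proof. by move=> Du; rewrite -[true :: _]/([:: true] ++ _ ++ _) dyck_remove. Qed.

(** First-passage decomposition: the displayed closing letter is the first step from height h+1 down
    to h. The excess [g] of the current height over h+1 is kept general for the induction. *)
Lemma walk_return g h k w : k <= h -> walk (g + h).+1 w = Some k ->
  exists u v, [/\ w = u ++ false :: v, walk g u = Some 0 & walk h v = Some k].
Proof.
move=> le_kh; elim: w g => [g [eq_k]|[] w IH g] /=.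
- by lia.
- rewrite -addSn => /IH [u [v [-> wu wv]]].
  by exists (true :: u), v.
- case: g => [|g]; first by move=> wv; exists [::], w.
  rewrite addSn => /IH [u [v [-> wu wv]]].
  by exists (false :: u), v.
Qed.

(** Last-passage decomposition: the displayed opening letter is the last step from height h up to
    h+1. *)
Lemma walk_last_open h w :
  walk 0 w = Some h.+1 ->
  exists u v, [/\ w = u ++ true :: v, walk 0 u = Some h & dyck v].
Proof.
have [m] := ubnP (size w); elim: m w h => // m IH w h.
case: (lastP w) => // {}w c; rewrite size_rcons ltnS => le_wm.
rewrite -cats1 walk_cat; case wE: (walk 0 w) => [k|] //=.
case: c => /=; first by move=> [<-]; exists w, [::].
case: k wE => // k wE [kE]; rewrite {}kE in wE.
(* If the last letter closes, the rest of the word ends at height h+2. Its last two unmatched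
   opening letters are split off; the inner one forms an arc with the last letter. *)
have [u [v [w_uv wu Dv]]] := IH _ _ le_wm wE.
have lt_um : size u < m by move: le_wm; rewrite w_uv size_cat /=; lia.
have [u' [v' [u_uv wu' Dv']]] := IH _ _ lt_um wu.
exists u', (v' ++ true :: v ++ [:: false]); split=> //; last exact/dyck_cat/dyck_arc.
by rewrite w_uv u_uv -!catA.
Qed.

Definition slice (i j : nat) (w : seq bool) : seq bool := take (j - i) (drop i w).

Lemma slice_split i p j w b : i <= p -> p < j -> p < size w ->
  slice i j w = slice i p w ++ nth b w p :: slice p.+1 j w.
Proof.
move=> le_ip lt_pj lt_pw; rewrite /slice.
have -> : j - i = (p - i) + (j - p.+1).+1 by lia.
by rewrite takeD drop_drop subnK // (drop_nth b lt_pw).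
Qed.

(** This is the matching of parentheses. It depends only on the letters from i to j, so arcs of a
    factor are arcs of the whole word. *)
Definition mate (w : seq bool) (i j : nat) : bool :=
  [&& i < j < size w, nth false w i, ~~ nth true w j
    & dyck (slice i.+1 j w)].

Lemma mateP w i j :
  reflect (exists a u b, [/\ w = a ++ true :: u ++ false :: b, dyck u,
                             i = size a & j = size a + (size u).+1])
          (mate w i j).
Proof.
rewrite /mate /slice.
apply: (iffP and4P) => [[/andP [lt_ij lt_jw] wi wj Du]|[a [u [b [-> Du -> ->]]]]].
  exists (take i w), (take (j - i.+1) (drop i.+1 w)), (drop j.+1 w).
  have szt : size (take i w) = i by rewrite size_takel //; lia.
  have szu : size (take (j - i.+1) (drop i.+1 w)) = j - i.+1.
    by rewrite size_takel // size_drop; lia.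
  split=> //; last by rewrite szt szu; lia.
  rewrite -{1}(cat_take_drop i w) (drop_nth false) ?wi; last by lia.
  congr (_ ++ _ :: _).
  rewrite -{1}(cat_take_drop (j - i.+1) (drop i.+1 w)) drop_drop.
  have -> : j - i.+1 + i.+1 = j by lia.
  by rewrite (drop_nth true lt_jw) (negbTE wj).
split=> //.
- by rewrite size_cat /= size_cat /=; lia.
- by rewrite nth_cat ltnn subnn.
- by rewrite nth_cat ltnNge leq_addr /= addKn /= nth_cat ltnn subnn.
- rewrite -cat1s catA drop_size_cat ?size_cat ?addn1 //.
  by rewrite addnS subSS addKn take_size_cat.
Qed.

Lemma mate_ctx a w b i j : mate w i j -> mate (a ++ w ++ b) (size a + i) (size a + j).
Proof.
case/mateP=> [a' [u [b' [-> Du -> ->]]]]; apply/mateP.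
exists (a ++ a'), u, (b' ++ b); split=> //; rewrite ?size_cat ?addnA //.
by rewrite -!catA /= -!catA.
Qed.

(** With two partners, the factor under the longer arc would start with a Dyck word followed by a
    closing letter, and so dip below 0. *)
Lemma mate_open_uniq w i j j' : mate w i j -> mate w i j' -> j = j'.
Proof.
suff no_lt k k' : k < k' -> mate w i k -> mate w i k' -> False.
  by case: (ltngtP j j') => // /no_lt H m1 m2; [case: (H m1 m2)|case: (H m2 m1)].
move=> lt_k /mateP [a [u [b [-> Du -> kE]]]] /mateP [a' [u' [b' [/eqP wE Du' sa kE']]]].
move: wE; rewrite eqseq_cat // => /andP [_] /eqP [] uE.
have lt_u : size u < size u' by lia.
have : take (size u') (u ++ false :: b) = u' by rewrite uE take_size_cat.
rewrite take_cat ltnNge (ltnW lt_u) /=.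
have [p ->] : exists p, size u' - size u = p.+1 by exists (size u' - size u).-1; lia.
move=> u'E; move: Du'; rewrite -u'E /dyck walk_cat (eqP Du) //.
Qed.

(** With two partners, the factor under the longer arc would end with an opening letter followed by
    a Dyck word, and so end at positive height. *)
Lemma mate_close_uniq w i i' j : mate w i j -> mate w i' j -> i = i'.
Proof.
suff no_lt k k' : k < k' -> mate w k j -> mate w k' j -> False.
  by case: (ltngtP i i') => // /no_lt H m1 m2; [case: (H m1 m2)|case: (H m2 m1)].
move=> lt_k /mateP [a [u [b [-> Du kE jE]]]] /mateP [a' [u' [b' [/eqP wE Du' kE' jE']]]].
move: wE; rewrite -!cat_cons !catA eqseq_cat; last first.
  by rewrite !size_cat /=; lia.
move=> /andP [/eqP wE _].
have : drop (size a).+1 (a ++ true :: u) = u.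
  by rewrite -cat1s catA drop_size_cat // size_cat addn1.
rewrite wE -(cat_take_drop (size a).+1 a') -catA drop_size_cat; last first.
  by rewrite size_takel //; lia.
move=> uE; move: Du; rewrite -uE /dyck walk_cat.
by case: (walk 0 _) => //= h; rewrite walk_dyck.
Qed.

(** The letters strictly between b and c begin the Dyck word under the arc from b to d, so they
    never descend below their initial height. Under the arc from a to c they follow the opening
    letter at b, so that factor would end at positive height. *)
Lemma mate_noncrossing w a b c d :
  a < b -> b < c -> c < d -> mate w a c -> mate w b d -> False.
Proof.
move=> lt_ab lt_bc lt_cd /and4P [/andP [_ cw] _ wc Dac] /and4P [/andP [_ dw] wb _ Dbd].
move: Dac; rewrite (slice_split false lt_ab lt_bc (ltn_trans lt_bc cw)) wb.
move: Dbd; rewrite (slice_split true lt_bc lt_cd cw) (negbTE wc) /dyck !walk_cat.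
case wy: (walk 0 (slice b.+1 c w)) => [k|] //= _.
by case: (walk 0 _) => //= h; rewrite -(addn0 h.+1) (walk_lift _ wy) addSn.
Qed.

Lemma exists_mate w i : dyck w -> i < size w ->
  if nth false w i then exists j, mate w i j else exists j, mate w j i.
Proof.
move=> Dw lt_iw; move: (Dw); rewrite /dyck.
have szt : size (take i w) = i by rewrite size_takel // ltnW.
rewrite -{1}(cat_take_drop i w) walk_cat (drop_nth false lt_iw).
case wt: (walk 0 (take i w)) => [h|] //=; case: ifPn => [wi|/negbTE wi].
  move=> /eqP /(@walk_return 0 h)-/(_ isT) [u [v [uE /eqP Du _]]].
  exists (i + (size u).+1); apply/mateP; exists (take i w), u, v; split=> //.
  - by rewrite -uE -[in RHS]wi -drop_nth // cat_take_drop.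
  - by rewrite szt.
case: h wt => // h /walk_last_open [u [v [uE _ Dv]]] _.
exists (size u); apply/mateP; exists u, v, (drop i.+1 w); split=> //.
- by rewrite -cat_cons catA -uE -[in RHS]wi -drop_nth // cat_take_drop.
- by rewrite -szt uE size_cat.
Qed.

(** * Non-crossing pairings as Dyck words *)

Section Words.
Variable n : nat.
Implicit Types (P : {set {set point n}}) (x y z t : point n).

Lemma paired_sym P x y : paired P x y = paired P y x.
Proof. by rewrite /paired /= eq_sym setUC. Qed.

Lemma exists_paired P x : is_pairing P -> exists y, paired P x y.
Proof.
case/andP=> /and3P [/eqP cov _ _] /forall_inP two.
have: x \in cover P by rewrite cov inE.
case/bigcupP=> B BP xB; have /cards2P [y [z [neq_yz BE]]] := two _ BP.
move: xB; rewrite BE !inE => /orP [] /eqP ->; [exists z|exists y].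
  by rewrite /paired /= neq_yz -BE.
by rewrite /paired /= eq_sym neq_yz setUC -BE.
Qed.

Lemma paired_uniq P x y z : is_pairing P -> paired P x y -> paired P x z -> y = z.
Proof.
case/andP=> /and3P [_ /trivIsetP triv _] _ /andP [neq_xy Pxy] /andP [neq_xz Pxz].
case: (eqVneq [set x; y] [set x; z]) => [eqB|/(triv _ _ Pxy Pxz)].
  have: y \in [set x; z] by rewrite -eqB !inE eqxx orbT.
  by rewrite !inE eq_sym (negbTE neq_xy) => /eqP.
by move=> /disjointFr => /(_ x); rewrite !inE eqxx => /(_ isT).
Qed.

Lemma noncrossing_paired P x y z t :
  noncrossing P -> x < y -> y < z -> z < t -> paired P x z -> paired P y t -> False.
Proof.
move=> /negP nc xy yz zt pxz pyt; apply: nc.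
apply/existsP; exists x; apply/existsP; exists y.
apply/existsP; exists z; apply/existsP; exists t.
by rewrite xy yz zt pxz pyt.
Qed.

Definition opening P : pred (point n) := fun x => [exists y : point n, (x < y) && paired P x y].

Definition word P : seq bool := [seq opening P x | x <- enum 'I_(2 * n)].

Lemma size_word P : size (word P) = 2 * n.
Proof. by rewrite size_map size_enum_ord. Qed.

Lemma nth_word P b x : nth b (word P) x = opening P x.
Proof. by rewrite (nth_map x) ?size_enum_ord // nth_ord_enum. Qed.

Lemma openingE P x y : is_pairing P -> paired P x y -> opening P x = (x < y).
Proof.
move=> pairP pxy; apply/existsP/idP => [[z /andP [lt_xz /(paired_uniq pairP pxy) ->]] //|].
by exists y; apply/andP.
Qed.

Lemma paired_neq P x y : paired P x y -> x <> y :> nat.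
Proof. by case/andP=> /eqP neq _ /val_inj. Qed.

Lemma closed_arc P x y z t : is_pairing P -> noncrossing P ->
  paired P x y -> paired P z t -> x < z < y -> x < t < y.
Proof.
move=> pairP ncP pxy pzt /andP [xz zy].
have tx : x <> t :> nat.
  move=> /val_inj tx; rewrite -tx paired_sym in pzt.
  by move: zy; rewrite (paired_uniq pairP pxy pzt) ltnn.
have ty : t <> y :> nat.
  move=> /val_inj ty; rewrite ty paired_sym in pzt; rewrite paired_sym in pxy.
  by move: xz; rewrite (paired_uniq pairP pxy pzt) ltnn.
case: (ltngtP x t) => // [xt|tx']; last first.
  by rewrite paired_sym in pzt; case: (noncrossing_paired ncP tx' xz zy pzt pxy).
case: (ltngtP t y) => // yt.
by case: (noncrossing_paired ncP xz zy yt pxy pzt).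
Qed.

(** The arc starting at the first point [a] cuts the interval into the part under the arc and the
    part after it. Both are again closed under the pairing, because no arc crosses this one, and
    both are shorter. *)
Lemma dyck_closed P a b : is_pairing P -> noncrossing P -> a <= b -> b <= 2 * n ->
  (forall x y, paired P x y -> a <= x < b -> a <= y < b) ->
  dyck (slice a b (word P)).
Proof.
move=> pairP ncP; have [m] := ubnP (b - a); elim: m a b => // m IH a b le_m.
rewrite leq_eqVlt => /predU1P [<-|lt_ab] le_b closed; first by rewrite /slice subnn take0.
pose x := Ordinal (leq_trans lt_ab le_b); have [y pxy] := exists_paired x pairP.
have [|ay yb] := andP (closed _ _ pxy _); first by rewrite /= leqnn.
have {ay} xy : a < y by rewrite ltn_neqAle ay andbT; exact/eqP/(paired_neq pxy).
have szw := size_word P.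
rewrite (slice_split false (leqnn a) lt_ab) ?szw; last by lia.
rewrite {1}/slice subnn take0 /= (nth_word P false x) (openingE pairP pxy) xy.
rewrite (slice_split true xy yb) ?szw; last by lia.
rewrite nth_word paired_sym in pxy *; rewrite (openingE pairP pxy) ltnNge (ltnW xy) /=.
rewrite paired_sym in pxy.
have Din : dyck (slice a.+1 y (word P)).
  apply: IH; [lia| exact: xy | lia |] => z t pzt; exact: (closed_arc pairP ncP pxy pzt).
have Dout : dyck (slice y.+1 b (word P)).
  apply: IH; [lia| exact: yb | lia |] => z t pzt /andP [yz zb].
  have /andP [at_ tb] : a <= t < b by apply: (closed _ _ pzt); lia.
  rewrite tb andbT ltnNge; apply/negP => ty.
  have tneq : t <> x.
    move=> tx; rewrite tx paired_sym in pzt.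
    by move: yz; rewrite (paired_uniq pairP pxy pzt) ltnn.
  have tneqy : t <> y.
    move=> tx; rewrite paired_sym in pxy; rewrite tx paired_sym in pzt.
    by move: yz; rewrite -(paired_uniq pairP pxy pzt) /= ltnNge (ltnW xy).
  rewrite paired_sym in pzt.
  have /andP [_ ] : x < z < y.
    apply: (closed_arc pairP ncP pxy pzt).
    rewrite /= !ltn_neqAle at_ ty !andbT; apply/andP; split; apply/eqP => E.
      by apply: tneq; apply: val_inj.
    by apply: tneqy; apply: val_inj.
  by rewrite ltnNge (ltnW yz).
by have := dyck_cat (dyck_arc Din) Dout; rewrite /= -catA.
Qed.

Lemma slice_full w : slice 0 (size w) w = w.
Proof. by rewrite /slice drop0 subn0 take_size. Qed.

Lemma dyck_word P : is_pairing P -> noncrossing P -> dyck (word P).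
Proof.
move=> pairP ncP; rewrite -(slice_full (word P)) size_word.
by apply: dyck_closed => // x y _ _; rewrite ltn_ord.
Qed.

(** The points under an arc of P are closed under P, hence spell a Dyck word. The converse follows
    because an opening letter has only one mate. *)
Lemma mate_word P x y : is_pairing P -> noncrossing P ->
  mate (word P) x y = (x < y) && paired P x y.
Proof.
move=> pairP ncP.
have mateW z t : z < t -> paired P z t -> mate (word P) z t.
  move=> zt pzt; rewrite /mate !nth_word zt size_word ltn_ord.
  rewrite (openingE pairP pzt) zt; rewrite (paired_sym P) in pzt.
  rewrite (openingE pairP pzt) ltnNge (ltnW zt) /=.
  apply: dyck_closed => //; first exact: ltnW (ltn_ord t).
  move=> u v; apply: closed_arc => //; by rewrite paired_sym.
apply/idP/andP => [mxy|[]]; last exact: mateW.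
have [/andP [xy _] ox _ _] := and4P mxy.
move: ox; rewrite nth_word => /existsP [z /andP [xz pxz]].
by split=> //; rewrite (_ : y = z) //; apply/val_inj/(mate_open_uniq mxy)/mateW.
Qed.

Lemma pairing_sub P Q : is_pairing P -> noncrossing P -> is_pairing Q -> noncrossing Q ->
  word P = word Q -> P \subset Q.
Proof.
move=> pairP ncP pairQ ncQ eq_w; apply/subsetP => B BP.
have /andP [_ /forall_inP two] := pairP.
have /cards2P [x [y [neq_xy BE]]] := two _ BP.
suff: paired Q x y by rewrite BE => /andP [].
wlog xy : x y neq_xy BE / x < y.
  case: (ltngtP x y) => [|yx H|/val_inj eq_xy]; first by auto.
    by rewrite paired_sym; apply: H; rewrite // 1?eq_sym // setUC.
  by rewrite eq_xy eqxx in neq_xy.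
have: mate (word P) x y by rewrite mate_word // xy /paired /= neq_xy -BE.
by rewrite eq_w mate_word // => /andP [].
Qed.

Lemma word_inj : {in nc_pairings n &, injective word}.
Proof.
move=> P Q; rewrite !inE => /andP [pP nP] /andP [pQ nQ] eq_w.
by apply/eqP; rewrite eqEsubset !pairing_sub.
Qed.

Definition pairing_of (w : seq bool) : {set {set point n}} :=
  [set B | [exists x : point n, exists y : point n, mate w x y && (B == [set x; y])]].

Lemma pairing_ofP w B :
  reflect (exists x y : point n, mate w x y /\ B = [set x; y]) (B \in pairing_of w).
Proof.
rewrite inE; apply: (iffP existsP) => [[x /existsP [y /andP [m /eqP ->]]]|[x [y [m ->]]]].
  by exists x, y.
by exists x; apply/existsP; exists y; rewrite m eqxx.
Qed.

Lemma mate_lt w i j : mate w i j -> i < j.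
Proof. by case/and4P=> /andP []. Qed.

Lemma mate_size w i j : mate w i j -> j < size w.
Proof. by case/and4P=> /andP []. Qed.

Lemma set2_inj (T : finType) (x y z t : T) :
  [set x; y] = [set z; t] -> (x = z /\ y = t) \/ (x = t /\ y = z).
Proof.
move=> E.
have: x \in [set z; t] by rewrite -E set21.
have: y \in [set z; t] by rewrite -E set22.
have: z \in [set x; y] by rewrite E set21.
have: t \in [set x; y] by rewrite E set22.
by rewrite !inE => /orP [] /eqP ? /orP [] /eqP ? /orP [] /eqP ? /orP [] /eqP ?; subst; auto.
Qed.

Lemma paired_pairing_of w x y :
  paired (pairing_of w) x y = mate w x y || mate w y x.
Proof.
apply/andP/orP => [[_ /pairing_ofP [z [t [m]]]]|].
  by case/set2_inj=> [[-> ->]|[-> ->]]; [left|right].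
case=> m; (split; first by apply/eqP => E; move: (mate_lt m); rewrite E ltnn).
  by apply/pairing_ofP; exists x, y.
by apply/pairing_ofP; exists y, x; rewrite setUC.
Qed.

Lemma pairing_of_pairing w : dyck w -> size w = 2 * n -> is_pairing (pairing_of w).
Proof.
move=> Dw szw.
have mate_uniq (x y z : nat) : mate w x y || mate w y x -> mate w x z || mate w z x -> y = z.
  have bad (i j k : nat) : mate w i j -> mate w k i -> False.
    move=> /and4P [_ wi _ _] /and4P [/andP [_ iw] _ wi' _].
    by rewrite (set_nth_default false) ?wi in wi'.
  move=> /orP [m1|m1] /orP [m2|m2].
  - exact: mate_open_uniq m1 m2.
  - by case: (bad _ _ _ m1 m2).
  - by case: (bad _ _ _ m2 m1).
  - exact: mate_close_uniq m1 m2.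
have block (x : point n) B : B \in pairing_of w -> x \in B ->
    exists2 y : point n, mate w x y || mate w y x & B = [set x; y].
  move=> /pairing_ofP [z [t [m ->]]]; rewrite !inE => /orP [] /eqP ->.
    by exists t; rewrite ?m.
  by exists z; rewrite ?m ?orbT // setUC.
apply/andP; split.
  apply/and3P; split.
  - apply/eqP/setP => x; rewrite inE; apply/bigcupP.
    have xw : x < size w by rewrite szw.
    have := exists_mate Dw xw; case: ifP => _ [j m].
      have jw := mate_size m; rewrite szw in jw.
      by exists [set x; Ordinal jw]; [apply/pairing_ofP; exists x, (Ordinal jw)|rewrite set21].
    have jw := ltn_trans (mate_lt m) xw; rewrite szw in jw.
    by exists [set Ordinal jw; x]; [apply/pairing_ofP; exists (Ordinal jw), x|rewrite set22].
  - apply/trivIsetP => B C BP CP neq; rewrite disjoint_subset; apply/subsetP => x xB.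
    rewrite inE; apply/negP => xC; move/eqP: neq; apply.
    have [y my ->] := block _ _ BP xB; have [z mz ->] := block _ _ CP xC.
    by rewrite (_ : y = z) //; apply/val_inj/(mate_uniq _ _ _ my mz).
  - by apply/negP => /pairing_ofP [x [y [_ /setP /(_ x)]]]; rewrite !inE eqxx.
apply/forall_inP => B /pairing_ofP [x [y [m ->]]]; rewrite cards2.
by case: (x =P y) => // E; move: (mate_lt m); rewrite E ltnn.
Qed.

Lemma pairing_of_noncrossing w : noncrossing (pairing_of w).
Proof.
apply/negP => /existsP [a /existsP [b /existsP [c /existsP [d]]]].
case/and5P=> ab bc cd; rewrite !paired_pairing_of.
move=> /orP [mac|/mate_lt]; last by lia.
move=> /orP [mbd|/mate_lt]; last by lia.
exact: mate_noncrossing ab bc cd mac mbd.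
Qed.

Lemma pairing_of_in w : dyck w -> size w = 2 * n -> pairing_of w \in nc_pairings n.
Proof.
by move=> Dw szw; rewrite inE pairing_of_pairing ?pairing_of_noncrossing.
Qed.

Lemma pairing_ofK w : dyck w -> size w = 2 * n -> word (pairing_of w) = w.
Proof.
move=> Dw szw; apply: (@eq_from_nth _ false); rewrite size_word ?szw // => i lt_i.
rewrite (nth_word _ _ (Ordinal lt_i)); apply/existsP/idP => [[y]|wi].
  rewrite paired_pairing_of /= => /andP [iy /orP [/and4P []//|/mate_lt]].
  by rewrite ltnNge (ltnW iy).
have := exists_mate Dw; rewrite szw => /(_ _ lt_i); rewrite wi => -[j m].
have jw := mate_size m; rewrite szw in jw.
by exists (Ordinal jw); rewrite paired_pairing_of /= m (mate_lt m).
Qed.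

End Words.

(** * Sweeping a pair of words from left to right *)

(** The list is the stack of a parenthesis parser: the positions of the opening letters still
    unmatched, innermost first. Everything between them is Dyck, so no closing letter is
    unmatched. *)
Inductive unmatched : seq bool -> seq nat -> Prop :=
| UnmatchedNil u : dyck u -> unmatched u [::]
| UnmatchedCons a u ps :
    unmatched a ps -> dyck u -> unmatched (a ++ true :: u) (size a :: ps).

Lemma unmatched_open x ps : unmatched x ps -> unmatched (rcons x true) (size x :: ps).
Proof. by move=> xps; rewrite -cats1; apply: UnmatchedCons. Qed.

Lemma unmatched_dyck x ps d : unmatched x ps -> dyck d -> unmatched (x ++ d) ps.
Proof.
case=> [u Du|a u {}ps aps Du] Dd; first by constructor; apply: dyck_cat.
by rewrite -catA; constructor=> //; apply: dyck_cat.
Qed.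

Lemma unmatched_close x p ps : unmatched x (p :: ps) ->
  unmatched (rcons x false) ps /\ mate (rcons x false) p (size x).
Proof.
move=> H; inversion H as [|a u ps' aps Du]; subst; split.
  by rewrite -cats1 -catA; apply: unmatched_dyck => //; apply: (dyck_arc Du).
apply/mateP; exists a, u, [::]; split=> //; last by rewrite size_cat.
by rewrite -cats1 -catA.
Qed.

Lemma unmatched_nil x : unmatched x [::] -> dyck x.
Proof. by move=> H; inversion H. Qed.

Lemma unmatched_lt x ps : unmatched x ps -> all (fun p => p < size x) ps.
Proof.
elim=> [//|a u {}ps _ IH _] /=; rewrite size_cat /= addnS ltnS leq_addr /=.
by apply: sub_all IH => p; lia.
Qed.

(* The component labels of the unmatched opening letters of the upper and of the lower word, the
   innermost one first. *)
Definition state : Type := (seq nat * seq nat)%type.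

(** Labels are mere names of components. Renumbering them by order of last occurrence identifies
    states that differ only by a renaming, which keeps the table of states small. *)
Definition canon (u l : seq nat) : state :=
  let r := undup (u ++ l) in ([seq index a r | a <- u], [seq index a r | a <- l]).

(* A component may not lose its last dangling end, which is why the last case can fail. *)
Definition step (s : state) (m : bool * bool) : option state :=
  match m, s with
  | (true, true), (u, l) => Some (0 :: map S u, 0 :: map S l)
  | (true, false), (u, b :: l) => Some (canon (b :: u) l)
  | (false, true), (a :: u, l) => Some (canon u (a :: l))
  | (false, false), (a :: u, b :: l) =>
      let merge c := if c == b then a else c in
      if a \in map merge (u ++ l) then Some (canon (map merge u) (map merge l)) else None
  | _, _ => None
  end.

Fixpoint run (s : state) (w : seq (bool * bool)) : option state :=
  if w is m :: w' then obind (run^~ w') (step s m) else Some s.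

Definition one_strand : state := ([:: 0], [:: 0]).

Section Soundness.
Variable E : rel nat.
Hypotheses (Erefl : reflexive E) (Esym : symmetric E) (Etrans : transitive E).

(** Here [f] assigns a component label to every swept position, and equal labels certify [E]. By the
    last clause every component still has a dangling end, so a state with a single label certifies
    that all positions are related. *)
Definition tracks (x y : seq bool) (s : state) : Prop :=
  exists (f : nat -> nat) (pu pl : seq nat),
    [/\ unmatched x pu, unmatched y pl, s = (map f pu, map f pl),
        forall i j, i < size x -> j < size x -> f i = f j -> E i j
      & forall i, i < size x -> f i \in map f pu ++ map f pl].

Lemma tracks_canon x y (u l : seq nat) : tracks x y (u, l) -> tracks x y (canon u l).
Proof.
move=> [f [pu [pl [upu upl [-> ->] fE fin]]]].
set r := undup (map f pu ++ map f pl).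
exists (fun i => index (f i) r), pu, pl; split=> //.
- by rewrite /canon -/r -!map_comp.
- move=> i j ilt jlt /(congr1 (nth 0 r)).
  by rewrite !nth_index ?mem_undup ?fin //; apply: fE.
- move=> i /fin; rewrite !mem_cat => /orP [] /mapP [p pin ->].
    by apply/orP; left; apply: (map_f (fun i => index (f i) r)).
  by apply/orP; right; apply: (map_f (fun i => index (f i) r)).
Qed.

Lemma tracks_step x y s m s' : size x = size y ->
  (forall i j, mate (rcons x m.1) i j -> E i j) ->
  (forall i j, mate (rcons y m.2) i j -> E i j) ->
  tracks x y s -> step s m = Some s' -> tracks (rcons x m.1) (rcons y m.2) s'.
Proof.
move=> szxy; set t := size x => mateX mateY [f [pu [pl [upu upl -> fE fin]]]].
have ltu : {in pu, forall p, p == t = false}.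
  by move=> p /(allP (unmatched_lt upu)); rewrite -/t; lia.
have ltl : {in pl, forall p, p == t = false}.
  by move=> p /(allP (unmatched_lt upl)); rewrite -szxy -/t; lia.
have map_ext (g : nat -> nat) (h : nat -> nat) c ps :
    {in ps, forall p, p == t = false} -> (forall i, g i = h (f i)) ->
    map (fun i => if i == t then c else g i) ps = map h (map f ps).
  move=> lt_ps gh; rewrite -map_comp; apply/eq_in_map => p /lt_ps -> /=; exact: gh.
case: m mateX mateY => [[] []] /= mateX mateY.
(* Two opening letters: the new position is a new component with label 0, and the old labels are
   shifted. *)
- move=> [<-]; exists (fun i => if i == t then 0 else (f i).+1), (t :: pu), (t :: pl).
  split; rewrite ?size_rcons -/t.
  + exact: unmatched_open.
  + by rewrite /t szxy; apply: unmatched_open.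
  + by rewrite /= eqxx !(map_ext _ S).
  + move=> i j; rewrite !ltnS; case: eqP => [->|/eqP it] ilt; case: eqP => [->|/eqP jt] jlt //.
    by move=> [/fE]; apply; rewrite -/t ltn_neqAle ?it ?jt.
  + move=> i ilt; rewrite /= eqxx; case: (i =P t) => [//|/eqP it].
    rewrite inE /= mem_cat inE !(map_ext _ S) //.
    have: f i \in map f pu ++ map f pl by apply: fin; rewrite -/t ltn_neqAle it.
    by rewrite mem_cat => /orP [] /(map_f S) ->; rewrite ?orbT.
(* The new position t closes the lower arc from q: it joins the component of q and becomes an upper
   dangling end. The next case is the mirror image. *)
- case: pl upl fE fin ltl => // q pl upl fE fin ltl [<-]; apply: tracks_canon.
  have [upl' mq] := unmatched_close upl; rewrite -szxy -/t in mq.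
  have Eqt := mateY _ _ mq; have qt : q < t.
    by have /andP [] := unmatched_lt upl; rewrite -szxy.
  exists (fun i => if i == t then f q else f i), (t :: pu), pl.
  have ltl' : {in pl, forall p, p == t = false}.
    by move=> p pin; apply: ltl; rewrite inE pin orbT.
  split; rewrite ?size_rcons -/t //.
  + exact: unmatched_open.
  + by rewrite /= eqxx !(map_ext _ id) // !map_id.
  + move=> i j; rewrite !ltnS; case: eqP => [->|/eqP it] ilt; case: eqP => [->|/eqP jt] jlt //.
    * move=> /fE H; apply: (Etrans _ (H _ _)); rewrite 1?Esym -/t //.
      by rewrite ltn_neqAle jt.
    * move=> /fE H; apply: (Etrans (H _ _)) => //; rewrite -/t //.
      by rewrite ltn_neqAle it.
    * by apply: fE; rewrite -/t ltn_neqAle ?it ?jt.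
  + move=> i ilt; rewrite /= eqxx inE !(map_ext _ id) // !map_id.
    case: (i =P t) => [_|/eqP it]; first by rewrite ?eqxx.
    have: f i \in map f pu ++ map f (q :: pl) by apply: fin; rewrite -/t ltn_neqAle it.
    by rewrite !mem_cat inE; case/or3P=> ->; rewrite ?orbT.
- case: pu upu fE fin ltu => // q pu upu fE fin ltu [<-]; apply: tracks_canon.
  have [upu' mq] := unmatched_close upu; rewrite -/t in mq.
  have Eqt := mateX _ _ mq; have qt : q < t.
    by have /andP [] := unmatched_lt upu.
  exists (fun i => if i == t then f q else f i), pu, (t :: pl).
  have ltu' : {in pu, forall p, p == t = false}.
    by move=> p pin; apply: ltu; rewrite inE pin orbT.
  split; rewrite ?size_rcons -/t //.
  + by rewrite /t szxy; apply: unmatched_open.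
  + by rewrite /= eqxx !(map_ext _ id) // !map_id.
  + move=> i j; rewrite !ltnS; case: eqP => [->|/eqP it] ilt; case: eqP => [->|/eqP jt] jlt //.
    * move=> /fE H; apply: (Etrans _ (H _ _)); rewrite 1?Esym -/t //.
      by rewrite ltn_neqAle jt.
    * move=> /fE H; apply: (Etrans (H _ _)) => //; rewrite -/t //.
      by rewrite ltn_neqAle it.
    * by apply: fE; rewrite -/t ltn_neqAle ?it ?jt.
  + move=> i ilt; rewrite /= eqxx !(map_ext _ id) // !map_id mem_cat inE.
    case: (i =P t) => [_|/eqP it]; first by rewrite ?eqxx orbT.
    have: f i \in map f (q :: pu) ++ map f pl by apply: fin; rewrite -/t ltn_neqAle it.
    by rewrite !mem_cat inE => /orP [/orP []|] ->; rewrite ?orbT.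
case: pu upu fE fin ltu => // p pu upu fE fin ltu.
case: pl upl fE fin ltl => // q pl upl fE fin ltl /=.
(* Both letters close: the arcs from p and from q meet at t, so the label of q is replaced by that
   of p. The test in [step] guarantees that the merged component keeps a dangling end. *)
set mg := (fun c => if c == f q then f p else c); case: ifP => // mem_p [<-].
apply: tracks_canon.
have [upu' mp] := unmatched_close upu; have [upl' mq] := unmatched_close upl.
rewrite -/t in mp; rewrite -szxy -/t in mq.
have Ept := mateX _ _ mp; have Eqt := mateY _ _ mq.
have pt : p < t by have /andP [] := unmatched_lt upu.
have qt : q < t by have /andP [] := unmatched_lt upl; rewrite -szxy.
have ltu' : {in pu, forall p, p == t = false}.
  by move=> p' pin; apply: ltu; rewrite inE pin orbT.
have ltl' : {in pl, forall p, p == t = false}.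
  by move=> p' pin; apply: ltl; rewrite inE pin orbT.
have Ep i : i < t -> mg (f i) = f p -> E i p.
  move=> ilt; rewrite /mg; case: eqP => [/fE iq _|_ /fE]; last by apply.
  by apply: (Etrans (iq _ _)) => //; apply: (Etrans Eqt); rewrite Esym.
exists (fun i => if i == t then f p else mg (f i)), pu, pl.
split; rewrite ?size_rcons -/t //.
- by rewrite !(map_ext _ mg).
- move=> i j; rewrite !ltnS; case: eqP => [->|/eqP it] ilt; case: eqP => [->|/eqP jt] jlt //.
  + move=> /esym fjp; have {jlt} jt : j < t by rewrite ltn_neqAle jt.
    by rewrite Esym; apply: (Etrans (Ep _ jt fjp)).
  + move=> fip; have {ilt} it : i < t by rewrite ltn_neqAle it.
    by apply: (Etrans (Ep _ it fip)).
  + have {ilt} it : i < t by rewrite ltn_neqAle it.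
    have {jlt} jt : j < t by rewrite ltn_neqAle jt.
    have [fjp fij|fjp] := eqVneq (mg (f j)) (f p).
      by apply: (Etrans (Ep _ it _)); rewrite 1?Esym ?Ep // fij.
    move: fjp; rewrite /mg; case: (f j =P f q) => _; first by rewrite eqxx.
    move=> fjp; case: eqP => _ fij; first by rewrite fij eqxx in fjp.
    exact: fE.
- move=> i ilt; rewrite !(map_ext _ mg) //.
  rewrite map_cat in mem_p; case: (i =P t) => [//|/eqP it].
  have: f i \in map f (p :: pu) ++ map f (q :: pl) by apply: fin; rewrite -/t ltn_neqAle it.
  rewrite !mem_cat !inE => /orP [/orP [/eqP ->|fi]|/orP [/eqP ->|fi]].
  + by rewrite /mg; case: eqP => _; rewrite -mem_cat.
  + by rewrite (map_f mg fi).
  + by rewrite /mg eqxx -mem_cat.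
  + by rewrite (map_f mg fi) orbT.
Qed.

Lemma tracks_run x y s w s' : size x = size y ->
  (forall i j, mate (x ++ unzip1 w) i j -> E i j) ->
  (forall i j, mate (y ++ unzip2 w) i j -> E i j) ->
  tracks x y s -> run s w = Some s' -> tracks (x ++ unzip1 w) (y ++ unzip2 w) s'.
Proof.
elim: w x y s => [|m w IH] x y s szxy mateX mateY; first by move=> H [<-]; rewrite !cats0.
move=> tr /=; case sm: (step s m) => [s1|] //= rw.
have extend (v v' : seq bool) i j : mate v i j -> mate (v ++ v') i j.
  exact: (mate_ctx [::]).
rewrite -!cat_rcons in mateX mateY *.
apply: (IH _ _ s1) => //; first by rewrite !size_rcons szxy.
by apply: (tracks_step szxy _ _ tr sm) => i j /extend H; [apply: mateX|apply: mateY].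
Qed.

End Soundness.

(** The first point creates the single strand and the last one closes it into a loop. The closing
    removes the last dangling ends, which [step] rejects, so it is added outside the sweep. *)
Definition enclose (v : seq (bool * bool)) := (true, true) :: rcons v (false, false).

(** All swept positions carry the label of the only dangling end p, and the final upper arc attaches
    the last position to p. *)
Lemma tracks_one_strand E x y : symmetric E -> transitive E -> size x = size y ->
  (forall i j, mate (rcons x false) i j -> E i j) ->
  tracks E x y one_strand ->
  [/\ dyck (rcons x false), dyck (rcons y false)
    & forall i j, i <= size x -> j <= size x -> E i j].
Proof.
move=> Esym Etrans szxy mateX [f [[|p [|? ?]] [[|q [|? ?]] [upu upl // [fp fq] fE fin]]]].
have [upu' mp] := unmatched_close upu; have [upl' mq] := unmatched_close upl.
have Ept := mateX _ _ mp; have pt : p < size x by have /andP [] := unmatched_lt upu.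
have Ep i : i <= size x -> E i p.
  rewrite leq_eqVlt => /predU1P [->|ilt]; first by rewrite Esym.
  by apply: fE => //; have := fin _ ilt; rewrite /= -fp -fq !inE orbb => /eqP.
split; [exact: unmatched_nil|exact: unmatched_nil|] => i j ilt jlt.
by apply: (Etrans _ _ _ (Ep _ ilt)); rewrite Esym Ep.
Qed.

Lemma unzip1_enclose v : unzip1 (enclose v) = rcons (true :: unzip1 v) false.
Proof. by rewrite /enclose /unzip1 /= map_rcons. Qed.

Lemma unzip2_enclose v : unzip2 (enclose v) = rcons (true :: unzip2 v) false.
Proof. by rewrite /enclose /unzip2 /= map_rcons. Qed.

(** The relation is an arbitrary equivalence containing the arcs. It is later taken to be
    connectivity in a meander system, and the total relation when only the Dyck property is
    wanted. *)
Lemma enclose_sound E v : reflexive E -> symmetric E -> transitive E ->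
  run one_strand v = Some one_strand ->
  (forall i j, mate (unzip1 (enclose v)) i j -> E i j) ->
  (forall i j, mate (unzip2 (enclose v)) i j -> E i j) ->
  [/\ dyck (unzip1 (enclose v)), dyck (unzip2 (enclose v))
    & forall i j, i < size (enclose v) -> j < size (enclose v) -> E i j].
Proof.
move=> Erefl Esym Etrans rv; rewrite unzip1_enclose unzip2_enclose => mateX mateY.
have prefix x i j : mate x i j -> mate (rcons x false) i j.
  by rewrite -cats1; apply: (mate_ctx [::]).
have tr0 : tracks E [:: true] [:: true] one_strand.
  exists (fun => 0), [:: 0], [:: 0]; split=> //;
    try exact: (@UnmatchedCons [::] [::] [::] (UnmatchedNil _)).
  by case=> [|i] [|j] //= _ _ _.
have tr : tracks E (true :: unzip1 v) (true :: unzip2 v) one_strand.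
  apply: (tracks_run Erefl Esym Etrans _ _ _ tr0 rv) => // i j /prefix.
    exact: mateX.
  exact: mateY.
have sz : size (true :: unzip1 v) = size (true :: unzip2 v) by rewrite /= !size_map.
have [Dx Dy conn] := tracks_one_strand Esym Etrans sz mateX tr; split=> // i j.
by rewrite /= size_rcons !ltnS => ? ?; apply: conn; rewrite /= size_map.
Qed.

(** * Counting blocks with a transfer operator *)

Definition moves : seq (bool * bool) :=
  [:: (true, true); (true, false); (false, true); (false, false)].

Definition transfer (g : state -> nat) (s : state) : nat :=
  \sum_(m <- moves) oapp g 0 (step s m).

Lemma count_run j s : count (fun w => run s w == Some one_strand) (strings moves j) =
  iter j transfer (fun t => t == one_strand) s.
Proof.
elim: j s => [|j IH] s; first by rewrite /= addn0.
have -> : strings moves j.+1 =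
  flatten [seq map (cons m) (strings moves j) | m <- moves] by [].
rewrite iterS /transfer count_flatten -map_comp sumnE big_map.
apply: eq_bigr => m _; rewrite /= count_map.
case sm: (step s m) => [t|] /=; first by rewrite -IH; apply: eq_count => w /=; rewrite sm.
by rewrite (eq_count (a2 := pred0)) ?count_pred0 // => w /=; rewrite sm.
Qed.

Lemma transfer_mono g g' : (forall s, g s <= g' s) -> forall s, transfer g s <= transfer g' s.
Proof. by move=> le_g s; apply: leq_sum => m _; case: (step s m) => /=. Qed.

Lemma transfer_scale c g s : transfer (fun t => c * g t) s = c * transfer g s.
Proof.
by rewrite /transfer big_distrr; apply: eq_bigr => m _; case: (step s m) => //=; rewrite muln0.
Qed.

(** The operator is monotone and linear, so a subeigenvector inequality can be iterated. For [g] the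
    indicator of [one_strand] this is the concatenation of r blocks. *)
Lemma iter_transfer_ge k c g r : (forall s, c * g s <= iter k transfer g s) ->
  forall s, c ^ r * g s <= iter (k * r) transfer g s.
Proof.
move=> step_ge; have mono j h h' : (forall s, h s <= h' s) ->
    forall s, iter j transfer h s <= iter j transfer h' s.
  by move=> le_h; elim: j => // j IH s; rewrite !iterS; apply: transfer_mono.
have scale j d h s : iter j transfer (fun t => d * h t) s = d * iter j transfer h s.
  elim: j s => // j IH s; rewrite !iterS -transfer_scale.
  by apply: eq_bigr => m _; case: (step s m) => /=.
elim: r => [|r IH] s; first by rewrite mul1n muln0.
rewrite mulnS addnC iterD; apply: leq_trans (mono _ _ _ step_ge s).
by rewrite scale expnS -mulnA leq_mul2l IH orbT.
Qed.

Lemma nat_of_bin_add a b : nat_of_bin (BinNat.N.add a b) = nat_of_bin a + nat_of_bin b.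
Proof. by case: a b => [|p] [|q] //=; rewrite ?addn0 // -nat_of_add_pos. Qed.

(** A state missing from the table counts as 0, so restricting to finitely many states can only
    lower the count. Binary integers make the evaluation feasible. *)
Fixpoint lookup (L : seq (state * BinNums.N)) (s : state) : BinNums.N :=
  if L is (t, c) :: L' then if t == s then c else lookup L' s else BinNums.N0.

Definition transfer_bin (L : seq (state * BinNums.N)) (s : state) : BinNums.N :=
  foldr (fun m c => BinNat.N.add (oapp (lookup L) BinNums.N0 (step s m)) c) BinNums.N0 moves.

Definition transfer_table (S : seq state) (L : seq (state * BinNums.N)) :=
  [seq (s, transfer_bin L s) | s <- S].

Lemma lookup_le (L : seq (state * BinNums.N)) (g : state -> nat) :
  (forall s c, (s, c) \in L -> c <= g s) ->
  forall s, lookup L s <= g s.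
Proof.
elim: L => // -[t c] L IH le_g s /=; case: eqP => [<-|_].
  by apply: le_g; rewrite mem_head.
by apply: IH => s' c' Lsc; apply: le_g; rewrite inE Lsc orbT.
Qed.

Lemma lookup_transfer_table S L (g : state -> nat) : (forall s, lookup L s <= g s) ->
  forall s, lookup (transfer_table S L) s <= transfer g s.
Proof.
move=> le_g; apply: lookup_le => s c /mapP [t _ [-> ->]].
rewrite /transfer /transfer_bin; move: moves => ms; elim: ms => [|m ms IH].
  by rewrite big_nil.
rewrite big_cons /= nat_of_bin_add leq_add //.
by case: (step t m) => //=.
Qed.

(* Only states with at most eight dangling strand ends are kept: this loses part of the
   count, but already gives more than 2^104 blocks of length 72. *)
Definition reachable : seq state :=
  iter 7 (fun S => undup (S ++ [seq s <- pmap id [seq step s m | s <- S, m <- moves]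
                                | size s.1 + size s.2 <= 8])) [:: one_strand].

Lemma nat_of_bin_exp2 k : nat_of_bin (iter k BinNat.N.double (BinNums.Npos BinNums.xH)) = 2 ^ k.
Proof.
elim: k => // k IH; rewrite iterS expnS -IH mul2n.
by case: (iter k _ _) => [|p] //=; rewrite NatTrec.doubleE.
Qed.

Lemma leq_nat_of_bin a b : BinNat.N.leb a b -> nat_of_bin a <= nat_of_bin b.
Proof. by move=> /BinNat.N.leb_le /BinNat.N.sub_add <-; rewrite nat_of_bin_add leq_addl. Qed.

(** There are 4^72 = 2^144 move sequences of this length; the 40 missing binary digits per block are
    the source of the factor 2^(40 r) below. *)
Lemma block_count : 2 ^ 104 <= iter 72 transfer (fun t => t == one_strand) one_strand.
Proof.
pose L := iter 72 (transfer_table reachable) [:: (one_strand, (BinNums.Npos BinNums.xH))].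
have le_L s : lookup L s <= iter 72 transfer (fun t => t == one_strand) s.
  rewrite /L; elim: 72 s => [|j IH] s; last by rewrite !iterS; apply: lookup_transfer_table.
  by rewrite /= [one_strand == s]eq_sym; case: eqP.
apply: leq_trans (le_L _); rewrite -nat_of_bin_exp2; apply: leq_nat_of_bin.
by vm_compute.
Qed.

(** * Counting Dyck words with prescribed factors *)

Definition dycks (m : nat) : seq (seq bool) :=
  [seq w <- strings [:: true; false] m | dyck w].

Lemma dycks_uniq m : uniq (dycks m).
Proof. exact/filter_uniq/strings_uniq. Qed.

Lemma mem_dycks m w : (w \in dycks m) = (size w == m) && dyck w.
Proof.
rewrite mem_filter mem_strings andbC (_ : all _ w) ?andbT //.
by apply/allP => -[].
Qed.

(** The ballot formula C(m,d) - C(m,d+1), where [d] is the number of closing letters, without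
    subtraction. Splitting on the first letter matches Pascal's rule. *)
Lemma ballot_count m h d : m + h = 2 * d ->
  'C(m, d.+1) + count (fun w => walk h w == Some 0) (strings [:: true; false] m) = 'C(m, d).
Proof.
elim: m h d => [|m IH] h d mhd; first by case: d mhd => [|d]; case: h => [|h] //; lia.
have -> : strings [:: true; false] m.+1 =
  map (cons true) (strings [:: true; false] m)
    ++ map (cons false) (strings [:: true; false] m) by rewrite /= cats0.
rewrite count_cat !count_map binS.
have := IH h.+1 d; rewrite addnS -addSn => /(_ mhd) Hup.
have Eup : count (preim (cons true) (fun w => walk h w == Some 0))
    (strings [:: true; false] m)
  = count (fun w => walk h.+1 w == Some 0) (strings [:: true; false] m) by apply: eq_count.
rewrite {}Eup; set down := count (preim (cons false) _) _.
case: h mhd Hup @down => [|h] mhd Hup down.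
  (* At height 0 no closing letter is possible; the absent term is compensated by the symmetry
     C(2e+1,e+1) = C(2e+1,e). *)
  have -> : down = 0 by rewrite /down (eq_count (a2 := pred0)) ?count_pred0.
  have [e dE] : exists e, d = e.+1 by exists d.-1; lia.
  have mE : m = e.*2.+1 by lia.
  have Esym : 'C(m, d) = 'C(m, e).
    by rewrite -bin_sub; [congr 'C(_, _); lia|lia].
  by move: Hup; rewrite dE binS -dE; lia.
have [e dE] : exists e, d = e.+1 by exists d.-1; lia.
have /IH Hdn : m + h = 2 * e by lia.
have -> : down = count (fun w => walk h w == Some 0) (strings [:: true; false] m).
  exact: eq_count.
by rewrite [in 'C(m.+1, d)]dE binS -dE; move: Hdn Hup; rewrite -dE; lia.
Qed.

Lemma size_dycks n : n.+1 * size (dycks (2 * n)) = 'C(2 * n, n).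
Proof.
rewrite /dycks size_filter; have := @ballot_count (2 * n) 0 n; rewrite addn0 => /(_ erefl).
have := mul_bin_left (2 * n) n; rewrite /dyck (_ : 2 * n - n = n); last by lia.
nia.
Qed.

Lemma size_dycksS n :
  n.+2 * size (dycks (2 * n.+1)) = 2 * (2 * n).+1 * size (dycks (2 * n)).
Proof.
apply/eqP; rewrite -(eqn_pmul2l (ltn0Sn n)); apply/eqP.
rewrite size_dycks.
have H1 : n.+1 * 'C(2 * n.+1, n.+1) = (2 * n.+1) * 'C((2 * n).+1, n).
  by rewrite -(mul_bin_diag (2 * n.+1) n) (_ : (2 * n.+1).-1 = (2 * n).+1) //; lia.
have H2 : n.+1 * 'C((2 * n).+1, n) = (2 * n).+1 * 'C(2 * n, n).
  have := mul_bin_down (2 * n).+1 n; rewrite (_ : (2 * n).+1 - n = n.+1) /=; lia.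
rewrite H1; rewrite -size_dycks in H2; move: H2; nia.
Qed.

Lemma dycks_gt0 n : 0 < size (dycks (2 * n)).
Proof.
have: 0 < 'C(2 * n, n) by rewrite bin_gt0; lia.
by rewrite -size_dycks muln_gt0 => /andP [].
Qed.

Definition insert (s : nat) (d w : seq bool) : seq bool := take s w ++ d ++ drop s w.

Lemma slice_insert s d w : s <= size w -> slice s (s + size d) (insert s d w) = d.
Proof.
move=> sw; rewrite /slice /insert drop_size_cat ?size_takel // addKn.
by rewrite take_size_cat.
Qed.

Lemma slice_cat i j u v : j <= size u -> slice i j (u ++ v) = slice i j u.
Proof.
move=> ju; rewrite /slice; have [ij|] := ltnP i j; last first.
  by rewrite -subn_eq0 => /eqP ->; rewrite !take0.
by rewrite drop_cat (leq_trans ij ju) takel_cat // size_drop; lia.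
Qed.

Lemma slice_insert_lt i j s d w : j <= s -> s <= size w ->
  slice i j (insert s d w) = slice i j w.
Proof.
move=> js sw; rewrite /insert slice_cat ?size_takel //.
by rewrite -[in RHS](cat_take_drop s w) slice_cat ?size_takel.
Qed.

(** Inserting or deleting a Dyck factor does not affect whether a word is Dyck, so cutting out [d]
    at place [s] is a bijection. *)
Lemma perm_insert s d m : dyck d -> s + size d <= m ->
  perm_eq [seq w <- dycks m | slice s (s + size d) w == d]
          [seq insert s d w | w <- dycks (m - size d)].
Proof.
move=> Dd le_m; apply: uniq_perm; first exact/filter_uniq/dycks_uniq.
  rewrite map_inj_in_uniq ?dycks_uniq // => v w; rewrite !mem_dycks.
  move=> /andP [/eqP sv _] /andP [/eqP sw _] /eqP.
  rewrite eqseq_cat ?size_takel ?sv ?sw //; try lia.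
  move=> /andP [/eqP tE]; rewrite eqseq_cat // => /andP [_ /eqP dE].
  by rewrite -(cat_take_drop s v) tE dE cat_take_drop.
move=> w; rewrite mem_filter mem_dycks; apply/and3P/mapP => [[/eqP wd /eqP sw Dw]|[v]].
  have wE : w = take s w ++ d ++ drop (s + size d) w.
    rewrite -{1}wd /slice addKn -{1}(cat_take_drop s w); congr (_ ++ _).
    by rewrite -{1}(cat_take_drop (size d) (drop s w)) drop_drop addnC.
  exists (take s w ++ drop (s + size d) w).
    rewrite mem_dycks -(dyck_remove _ _ Dd) -wE Dw andbT.
    by rewrite size_cat size_takel ?size_drop ?sw; lia.
  have szt : size (take s w) = s by rewrite size_takel // sw; lia.
  by rewrite /insert take_size_cat // drop_size_cat.
rewrite mem_dycks => /andP [/eqP sv Dv ->].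
rewrite slice_insert. 2: by rewrite sv; lia.
rewrite eqxx /insert !size_cat size_takel ?size_drop ?sv; last by lia.
split=> //; first by rewrite addnA -subnDA [size d + s]addnC subnKC.
by rewrite dyck_remove // cat_take_drop.
Qed.

Lemma count_slice s d m : dyck d -> s + size d <= m ->
  count (fun w => slice s (s + size d) w == d) (dycks m) = size (dycks (m - size d)).
Proof.
by move=> Dd le_m; rewrite -size_filter (perm_size (perm_insert Dd le_m)) size_map.
Qed.

(** The right factor is cut out first, which leaves the left one at its place. *)
Lemma count_slice2 s t d e m : dyck d -> dyck e -> s + size d <= t -> t + size e <= m ->
  count (fun w => (slice s (s + size d) w == d) && (slice t (t + size e) w == e)) (dycks m)
  = size (dycks (m - size e - size d)).
Proof.
move=> Dd De le_t le_m.
rewrite -(@count_slice s d (m - size e)) //; last by lia.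
rewrite -size_filter filter_predI size_filter.
rewrite (permP (perm_insert De le_m)) count_map; apply: eq_in_count => w.
rewrite mem_dycks => /andP [/eqP sw _] /=.
by rewrite slice_insert_lt // sw; lia.
Qed.

(** Since [F] has no repetitions, membership is a sum of indicators over its elements. After
    exchanging sums, each element contributes a product of two counts. *)
Lemma sum_pair_mem (T U : eqType) (D : seq T) (a : T -> U) (F : seq (U * U)) c :
  uniq F ->
  (forall f, f \in F -> count (fun x => a x == f.1) D = c
                     /\ count (fun x => a x == f.2) D = c) ->
  \sum_(x <- D) \sum_(y <- D) ((a x, a y) \in F : nat) = size F * c ^ 2.
Proof.
move=> uF cF.
have memE (p : U * U) : (p \in F : nat) = \sum_(f <- F) (p == f : nat).
  rewrite -count_uniq_mem // -sum1_count big_mkcond /=.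
  by apply: eq_bigr => f _; rewrite eq_sym; case: eqP.
under eq_bigr do under eq_bigr do rewrite memE.
under eq_bigr do rewrite exchange_big.
rewrite exchange_big /=.
transitivity (\sum_(f <- F) c ^ 2); last first.
  by rewrite big_const_seq count_predT iter_addn_0 mulnC.
apply: eq_big_seq => -[f1 f2] /cF [/= c1 c2].
have cntE (b : T -> bool) : \sum_(x <- D) (b x : nat) = count b D.
  by rewrite -sum1_count [RHS]big_mkcond /=; apply: eq_bigr => x _; case: (b x).
under eq_bigr do under eq_bigr do rewrite xpair_eqE -mulnb.
under eq_bigr do rewrite -big_distrr /= cntE c2.
by rewrite -big_distrl /= cntE c1.
Qed.

(** * First and second moment of the number of successful windows *)

Section Moments.
Variables (F : seq (seq bool * seq bool)) (l m k : nat).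
Hypothesis uF : uniq F.
Hypothesis dyckF :
  forall f, f \in F -> [/\ size f.1 = l, size f.2 = l, dyck f.1 & dyck f.2].
Hypothesis fit : l * k <= m.

Definition window (j : nat) (w : seq bool) : seq bool := slice (l * j) (l * j + l) w.

Definition hit (j : nat) (x y : seq bool) : bool := (window j x, window j y) \in F.

Definition hits (x y : seq bool) : nat := \sum_(j < k) hit j x y.

Lemma sum_hit (j : 'I_k) :
  \sum_(x <- dycks m) \sum_(y <- dycks m) hit j x y
  = size F * size (dycks (m - l)) ^ 2.
Proof.
have le_j : l * j + l <= m.
  by rewrite -mulnSr; apply: leq_trans fit; rewrite leq_mul2l ltn_ord orbT.
have cnt d : size d = l -> dyck d ->
    count (fun w => window j w == d) (dycks m) = size (dycks (m - l)).
  by move=> sd Dd; rewrite -[in RHS]sd -(@count_slice (l * j)) ?sd.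
by apply: sum_pair_mem => // f /dyckF [? ? ? ?]; rewrite !cnt.
Qed.

Lemma sum_hit2 (i j : 'I_k) : i != j ->
  \sum_(x <- dycks m) \sum_(y <- dycks m) (hit i x y && hit j x y)
  = size F ^ 2 * size (dycks (m - l - l)) ^ 2.
Proof.
wlog lt_ij : i j / i < j => [H|_].
  case: (ltngtP i j) => [/H//|ji _|/val_inj ->]; last by rewrite eqxx.
  rewrite -(H _ _ ji) -1?val_eqE /= ?ltn_eqF //.
  by under eq_bigr do under eq_bigr do rewrite andbC.
pose a w := (window i w, window j w).
(* Success in both windows is a single membership once the two windows of each word are grouped
   together, so [sum_pair_mem] applies again. *)
pose F2 := [seq ((f.1, g.1), (f.2, g.2)) | f <- F, g <- F].
have mem_F2 u v u' v' : (((u, v), (u', v')) \in F2) = ((u, u') \in F) && ((v, v') \in F).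
  apply/allpairsP/andP => [[[[? ?] [? ?]] [/= ? ? [-> -> -> ->]]] //|[uF' vF']].
  by exists ((u, u'), (v, v')).
transitivity (\sum_(x <- dycks m) \sum_(y <- dycks m) ((a x, a y) \in F2 : nat)).
  by apply: eq_bigr => x _; apply: eq_bigr => y _; rewrite mem_F2.
rewrite (@sum_pair_mem _ _ _ _ _ (size (dycks (m - l - l)))).
- by rewrite size_allpairs mulnn.
- by apply: allpairs_uniq => // -[[? ?] [? ?]] [[? ?] [? ?]] _ _ [-> -> -> ->].
have le_i : l * i + l <= l * j by rewrite -mulnSr leq_mul2l lt_ij orbT.
have le_j : l * j + l <= m.
  by rewrite -mulnSr; apply: leq_trans fit; rewrite leq_mul2l ltn_ord orbT.
have cnt d e : size d = l -> size e = l -> dyck d -> dyck e ->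
    count (fun w => a w == (d, e)) (dycks m) = size (dycks (m - l - l)).
  move=> sd se Dd De; rewrite -{2}sd -se -(@count_slice2 (l * i) (l * j)) ?sd ?se //.
move=> f /allpairsP [[f1 f2] [/dyckF [? ? ? ?] /dyckF [? ? ? ?] ->]] /=.
by rewrite !cnt.
Qed.

Lemma sum_hits :
  \sum_(x <- dycks m) \sum_(y <- dycks m) hits x y = k * (size F * size (dycks (m - l)) ^ 2).
Proof.
under eq_bigr do rewrite exchange_big.
rewrite exchange_big /= -[k in k * _]card_ord -sum_nat_const.
by apply: eq_bigr => j _; rewrite sum_hit.
Qed.

(** The diagonal of the expanded square is the first moment. The k(k-1) off-diagonal terms have a
    common value, and k^2 copies of it bound them. *)
Lemma sum_hits_sqr :
  \sum_(x <- dycks m) \sum_(y <- dycks m) hits x y ^ 2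
  <= k * (size F * size (dycks (m - l)) ^ 2)
     + k ^ 2 * (size F ^ 2 * size (dycks (m - l - l)) ^ 2).
Proof.
have sqrE x y : hits x y ^ 2 =
    \sum_(j < k) hit j x y + \sum_(i < k) \sum_(j < k | i != j) (hit i x y && hit j x y).
  rewrite -mulnn {1}/hits big_distrl -big_split /=; apply: eq_bigr => i _.
  rewrite /hits big_distrr (bigD1 i) //= mulnb andbb; congr (_ + _).
  by apply: eq_big => [j|j _]; rewrite ?mulnb // eq_sym.
under eq_bigr do under eq_bigr do rewrite sqrE.
under eq_bigr do rewrite big_split.
rewrite big_split /= leq_add //; first by rewrite -sum_hits.
under eq_bigr do rewrite exchange_big.
rewrite exchange_big /=.
have -> : k ^ 2 * (size F ^ 2 * size (dycks (m - l - l)) ^ 2) =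
    \sum_(i < k) \sum_(j < k) size F ^ 2 * size (dycks (m - l - l)) ^ 2.
  by rewrite !sum_nat_const card_ord [RHS]mulnA mulnn.
apply: leq_sum => i _.
under eq_bigr do rewrite exchange_big.
rewrite exchange_big /= [X in X <= _]big_mkcond /=.
by apply: leq_sum => j _; case: ifP => // ij; rewrite sum_hit2.
Qed.

End Moments.

(** * From fully connected windows to the largest cycle *)

Definition loop_pairs (r : nat) : seq (seq bool * seq bool) :=
  [seq (unzip1 (enclose v), unzip2 (enclose v))
  | v <- strings moves (72 * r) & run one_strand v == Some one_strand].

Lemma loop_pairs_uniq r : uniq (loop_pairs r).
Proof.
rewrite map_inj_uniq; first exact/filter_uniq/strings_uniq.
move=> v w /= [E1 E2]; have: enclose v = enclose w.
  by rewrite -(zip_unzip (enclose v)) -(zip_unzip (enclose w)) /= E1 E2.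
by rewrite /enclose => -[/rcons_inj []].
Qed.

Lemma size_loop_pairs r : 2 ^ (104 * r) <= size (loop_pairs r).
Proof.
rewrite size_map size_filter count_run.
have step_ge s : 2 ^ 104 * (s == one_strand) <= iter 72 transfer (fun t => t == one_strand) s.
  by case: eqP => [->|_]; rewrite ?muln0 // muln1 block_count.
have := iter_transfer_ge r step_ge one_strand.
by rewrite eqxx muln1 -expnM.
Qed.

Lemma loop_pairsP r f : f \in loop_pairs r ->
  exists v, [/\ f = (unzip1 (enclose v), unzip2 (enclose v)),
                size (enclose v) = 2 * (36 * r + 1)
              & run one_strand v = Some one_strand].
Proof.
case/mapP=> v; rewrite mem_filter mem_strings => /and3P [/eqP rv /eqP sv _] ->.
by exists v; split=> //; rewrite /= size_rcons sv; lia.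
Qed.

Lemma loop_pairs_dyck r f : f \in loop_pairs r ->
  [/\ size f.1 = 2 * (36 * r + 1), size f.2 = 2 * (36 * r + 1), dyck f.1 & dyck f.2].
Proof.
case/loop_pairsP=> v [-> sv rv]; rewrite -sv /= !size_map.
by have [] := @enclose_sound (fun _ _ => true) v _ _ _ rv.
Qed.

Lemma hit_largest_half_length n r j (P Q : {set {set point n}}) :
  P \in nc_pairings n -> Q \in nc_pairings n ->
  (2 * (36 * r + 1)) * j.+1 <= 2 * n ->
  hit (loop_pairs r) (2 * (36 * r + 1)) j (word P) (word Q) ->
  36 * r + 1 <= largest_half_length (P, Q).
Proof.
rewrite !inE => /andP [pP nP] /andP [pQ nQ]; set l := 2 * (36 * r + 1).
rewrite /hit /window; set s := l * j => fit /loop_pairsP [v [[E1 E2] sv rv]].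
have fit' : s + l <= 2 * n by rewrite -mulnSr.
have l_gt0 : 0 < l by rewrite /l; lia.
have n_gt0 : 0 < 2 * n by lia.
pose x0 : point n := Ordinal n_gt0.
pose pt i := insubd x0 (s + i) : point n.
have val_pt i : s + i < 2 * n -> val (pt i) = s + i.
  by move=> lt_i; rewrite /pt /insubd insubT.
pose e := edge (P, Q).
have e_sym : symmetric e by move=> x y; rewrite /e /edge /= !(paired_sym _ x).
(* Connectivity is pulled back to offsets in the window. Out of range [pt] takes the value [x0], and
   the pullback is still an equivalence relation on all naturals. *)
pose E : rel nat := fun i k => connect e (pt i) (pt k).
have mate_pt (S : {set {set point n}}) i k : is_pairing S -> noncrossing S ->
    mate (slice s (s + l) (word S)) i k -> paired S (pt i) (pt k).
  move=> pS nS m; have szS := size_word S.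
  have sz_take : size (take s (word S)) = s by rewrite size_takel // szS; lia.
  have := mate_ctx (take s (word S)) (drop (s + l) (word S)) m.
  have -> : take s (word S) ++ slice s (s + l) (word S) ++ drop (s + l) (word S) = word S.
    by rewrite /slice addKn [s + l]addnC -drop_drop !cat_take_drop.
  rewrite sz_take => mS; have lt_k := mate_size mS; have lt_i := mate_lt mS.
  rewrite szS in lt_k.
  have := mate_word (pt i) (pt k) pS nS; rewrite !val_pt //; last exact: ltn_trans lt_k.
  by rewrite mS => /esym /andP [].
have [||||| _ _ conn] := @enclose_sound E v _ _ _ rv.
- by move=> i; apply: connect0.
- by move=> i k; apply: (sym_connect_sym e_sym).
- by move=> i k t; apply: connect_trans.
- move=> i k; rewrite -[unzip1 _]E1 => /(mate_pt _ _ _ pP nP) p.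
  by apply: connect1; rewrite /e /edge /= p.
- move=> i k; rewrite -[unzip2 _]E2 => /(mate_pt _ _ _ pQ nQ) p.
  by apply: connect1; rewrite /e /edge /= p orbT.
pose C := [set y in [set: point n] | connect e (pt 0) y].
have CM : C \in cycle_supports (P, Q) by apply/imsetP; exists (pt 0).
apply: leq_trans (leq_bigmax_cond _ CM); rewrite /half_length.
suff: l <= #|C| by move=> /half_leq; apply: leq_trans; rewrite /l mul2n doubleK.
rewrite -[X in X <= _]card_ord.
have inj_pt : injective (fun i : 'I_l => pt i).
  move=> i k /(congr1 val); rewrite !val_pt.
  - by move=> /addnI /val_inj.
  - by have := ltn_ord k; lia.
  - by have := ltn_ord i; lia.
rewrite -(card_imset _ inj_pt) subset_leq_card //; apply/subsetP => _ /imsetP [i _ ->].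
by rewrite !inE; apply: conn; rewrite sv.
Qed.

Lemma perm_word n : perm_eq [seq word P | P <- enum (nc_pairings n)] (dycks (2 * n)).
Proof.
apply: uniq_perm (dycks_uniq _) _.
  rewrite map_inj_in_uniq ?enum_uniq // => P Q; rewrite !mem_enum; exact: word_inj.
move=> w; rewrite mem_dycks; apply/mapP/andP => [[P + ->]|[/eqP sw Dw]].
  rewrite mem_enum inE size_word eqxx => /andP [pP nP]; split=> //; exact: dyck_word.
by exists (pairing_of n w); rewrite ?mem_enum ?pairing_of_in ?pairing_ofK.
Qed.

Lemma card_nc_pairings n : #|nc_pairings n| = size (dycks (2 * n)).
Proof. by rewrite cardE -(size_map (@word n)); apply/perm_size/perm_word. Qed.

Local Open Scope ring_scope.

Lemma sum_nc_pairings (V : nmodType) n (g : seq bool -> V) :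
  \sum_(P in nc_pairings n) g (word P) = \sum_(w <- dycks (2 * n)) g w.
Proof. by rewrite -big_enum -(perm_big _ (perm_word n)) big_map. Qed.

(** * Catalan estimates and the second moment bound *)

Lemma size_dycks_le n k :
  (size (dycks (2 * (n + k))) <= 4 ^ k * size (dycks (2 * n)))%N.
Proof.
elim: k => [|k IH]; first by rewrite addn0 mul1n.
rewrite addnS expnS -mulnA; apply: leq_trans (leq_mul (leqnn 4) IH).
have := size_dycksS (n + k); nia.
Qed.

Lemma size_dycksS_real (R : realFieldType) n :
  (size (dycks (2 * n.+1)))%:R
  = 4 * (1 - 3 / (2 * (n%:R + 2))) * (size (dycks (2 * n)))%:R :> R.
Proof.
have := size_dycksS n; move: (size _) (size _) => c0 c1 E.
have n_ge0 : 0 <= n%:R :> R by [].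
have {}E : (n%:R + 2) * c1%:R = 2 * (2 * n%:R + 1) * c0%:R :> R.
  have: (n.+2 * c1)%N%:R = (2 * (2 * n).+1 * c0)%N%:R :> R by rewrite E.
  rewrite !natrM -(addn2 n) -(addn1 (2 * n)). by rewrite (natrD _ n) (natrD _ (2 * n)) natrM.
apply: (@mulfI _ (n%:R + 2)); first by apply: lt0r_neq0; lra.
by rewrite E; field; apply: lt0r_neq0; lra.
Qed.

(** Each of the k successive Catalan ratios is at least 4(1 - d) with d = 3/(2(n+2)), and (1 - d)^k
    >= 1 - k d by Bernoulli's inequality. *)
Lemma size_dycks_ge (R : realFieldType) n k :
  4 ^+ k * (1 - k%:R * (3 / (2 * (n%:R + 2)))) * (size (dycks (2 * n)))%:R
  <= (size (dycks (2 * (n + k))))%:R :> R.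
Proof.
elim: k => [|k IH]; first by rewrite addn0 mul0r subr0 !mul1r.
rewrite addnS size_dycksS_real; move: IH.
set c : R := (size (dycks (2 * n)))%:R.
set c' : R := (size (dycks (2 * (n + k))))%:R => IH.
have n_ge0 : 0 <= n%:R :> R by []. have k_ge0 : 0 <= k%:R :> R by [].
set d : R := 3 / (2 * (n%:R + 2)).
have d_ge0 : 0 <= d by apply: divr_ge0 => //; lra.
have d_le1 : d <= 1 by rewrite ler_pdivrMr; lra.
have d_le : 3 / (2 * ((n + k)%:R + 2)) <= d.
  by rewrite natrD ler_pM2l ?lef_pV2 ?posrE; lra.
have c_ge0 : 0 <= 4 ^+ k * c by rewrite mulr_ge0 ?exprn_ge0.
have step1 : (1 - d) * (4 ^+ k * (1 - k%:R * d) * c) <= (1 - d) * c'.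
  by have d1 : 0 <= 1 - d; [lra|exact: (ler_wpM2l d1 IH)].
have step2 : (1 - d) * c' <= (1 - 3 / (2 * ((n + k)%:R + 2))) * c'.
  by apply: ler_wpM2r; rewrite ?ler0n //; lra.
have step3 : 0 <= k%:R * (d * d) * (4 ^+ k * c).
  exact: (mulr_ge0 (mulr_ge0 k_ge0 (mulr_ge0 d_ge0 d_ge0)) c_ge0).
move: step1 step2 step3; rewrite exprS -(natr1 k).
move: (3 / _) (_ ^+ k) => d' x step1 step2 step3.
have -> : 4 * x * (1 - (k%:R + 1) * d) * c =
    4 * ((1 - d) * (x * (1 - k%:R * d) * c) - k%:R * (d * d) * (x * c)) by ring.
by lra.
Qed.

(** With X the number of hits, the half-length is at least h when X > 0, and 2aX - a^2 X^2 = 1 - (1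
    - aX)^2 is at most 1 and vanishes at X = 0. Averaging gives a second moment bound with a free
    parameter [a]. *)
Lemma expected_half_length_ge (R : realType) n r h k (a s1 s2 : R) :
  let c i := (size (dycks (2 * (n - i))))%:R : R in
  let f := (size (loop_pairs r))%:R : R in
  h = (36 * r + 1)%N -> k = (n %/ h)%N ->
  s1 = k%:R * (f * c h ^+ 2) ->
  s2 = k%:R ^+ 2 * (f ^+ 2 * c (2 * h)%N ^+ 2) ->
  h%:R * (2 * a * s1 - a ^+ 2 * (s1 + s2)) / c 0%N ^+ 2
  <= expected_largest_half_length R n.
Proof.
move=> c f hE kE s1E s2E.
rewrite /expected_largest_half_length /uniform_expectation /meander_systems.
rewrite cardsX !card_nc_pairings /c subn0 natrM -expr2 ler_pM2r; last first.
  by rewrite invr_gt0 exprn_gt0 // ltr0n dycks_gt0.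
set l := (2 * h)%N; set D := dycks (2 * n).
have fit : (l * k <= 2 * n)%N by rewrite -mulnA leq_mul2l mulnC kE leq_trunc_div.
pose X := hits (loop_pairs r) l k.
have lower (M : {set {set point n}} * {set {set point n}}) :
    M \in setX (nc_pairings n) (nc_pairings n) ->
    h%:R * (2 * a * (X (word M.1) (word M.2))%:R - a ^+ 2 * (X (word M.1) (word M.2) ^ 2)%:R)
    <= (largest_half_length M)%:R.
  case: M => P Q /setXP [/= PA QA]; set x := X _ _.
  have [x0|] := posnP x.
    by rewrite x0 !mulr0 subr0 mulr0 ler0n.
  rewrite lt0n sum_nat_eq0 => /forall_inPn [/= j _]; rewrite eqb0 negbK => hit_j.
  have big : (h <= largest_half_length (P, Q))%N.
    rewrite hE; apply: (hit_largest_half_length PA QA (j := j)); rewrite -hE //.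
    by apply: leq_trans fit; rewrite leq_mul2l ltn_ord orbT.
  apply: (@le_trans _ _ h%:R); last by rewrite ler_nat.
  rewrite -{2}[h%:R]mulr1 ler_wpM2l // natrX -subr_ge0.
  by rewrite (_ : _ - _ = (1 - a * x%:R) ^+ 2) ?sqr_ge0 //; ring.
apply: le_trans (ler_sum _ lower).
rewrite -mulr_sumr ler_wpM2l //.
have sumE (g : seq bool -> seq bool -> R) :
    \sum_(M in setX (nc_pairings n) (nc_pairings n)) g (word M.1) (word M.2)
    = \sum_(x <- D) \sum_(y <- D) g x y.
  rewrite -(sum_nc_pairings n (fun x => \sum_(y <- D) g x y)).
  under [RHS]eq_bigr do rewrite -(sum_nc_pairings n (g _)).
  rewrite pair_big /=; apply: eq_bigl => -[P Q] /=; exact: in_setX.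
rewrite (sumE (fun x y => 2 * a * (X x y)%:R - a ^+ 2 * (X x y ^ 2)%:R)).
under eq_bigr do rewrite sumrB -!mulr_sumr -!natr_sum.
rewrite sumrB -!mulr_sumr -!natr_sum.
have fdyck f0 : f0 \in loop_pairs r ->
    [/\ size f0.1 = l, size f0.2 = l, dyck f0.1 & dyck f0.2].
  by rewrite /l hE; apply: loop_pairs_dyck.
have := sum_hits_sqr (loop_pairs_uniq r) fdyck fit.
have := sum_hits (loop_pairs_uniq r) fdyck fit.
rewrite -/X -/D; set S1 := (\sum_(x <- _) _)%N; set S2 := (\sum_(x <- _) _)%N.
have -> : (2 * n - l - l = 2 * (n - 2 * h))%N by rewrite /l; lia.
have -> : (2 * n - l = 2 * (n - h))%N by rewrite /l; lia.
move=> S1_E le_S2.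
have -> : S1%:R = s1 by rewrite S1_E natrM natrM natrX s1E.
rewrite lerD2l lerN2; apply: ler_wpM2l; first exact: sqr_ge0.
by rewrite s1E s2E -!natrX -!natrM -natrD ler_nat.
Qed.

(** The choice of [a] is the inverse of the mean number of hits s/c0^2. The expression becomes 2 - u
    - v^2, with u the inverse mean and v = c0 c2/c1^2 the correlation ratio, and 2 - 1/200 -
    (1000/999)^2 > 0.99. *)
Lemma moment_ratio_ge (R : realFieldType) (c0 c1 c2 k f s : R) :
  0 < c0 -> 0 < c1 -> 0 < c2 -> 0 < s -> s = k * (f * c1 ^+ 2) ->
  200 * c0 ^+ 2 <= s -> 999 / 1000 * (c0 * c2) <= c1 ^+ 2 ->
  let a := c0 ^+ 2 / s in
  is_true (99 / 100 <= (2 * a * s - a ^+ 2 * (s + k ^+ 2 * (f ^+ 2 * c2 ^+ 2))) / c0 ^+ 2).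
Proof.
move=> c0_gt0 c1_gt0 c2_gt0 s_gt0 sE le_s le_c1 a.
have c0_neq0 : c0 != 0 by rewrite gt_eqF.
have c1_neq0 : c1 != 0 by rewrite gt_eqF.
have s_neq0 : s != 0 by rewrite gt_eqF.
pose u := c0 ^+ 2 / s; pose v := c0 * c2 / c1 ^+ 2.
have -> : (2 * a * s - a ^+ 2 * (s + k ^+ 2 * (f ^+ 2 * c2 ^+ 2))) / c0 ^+ 2
    = 2 - u - v ^+ 2.
  have kf : k * f = s / c1 ^+ 2 by rewrite sE; field.
  have -> : k ^+ 2 * (f ^+ 2 * c2 ^+ 2) = (k * f) ^+ 2 * c2 ^+ 2 by ring.
  rewrite kf /a /u /v; field.
  by rewrite c1_neq0 s_neq0 c0_neq0.
have u_le : u <= 1 / 200 by rewrite ler_pdivrMr //; lra.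
have v_ge0 : 0 <= v by rewrite divr_ge0 ?mulr_ge0 ?exprn_ge0 ?ltW.
have v_le : v <= 1000 / 999 by rewrite ler_pdivrMr ?exprn_gt0 //; lra.
have : v ^+ 2 <= (1000 / 999) ^+ 2 by rewrite lerXn2r ?nnegrE //; lra.
move: u_le; lra.
Qed.

Lemma expected_largest_half_length_lower (R : realType) n r :
  (3200 * (36 * r + 1) * 2 ^ (40 * r) <= n)%N ->
  99 / 100 * (36 * r + 1)%:R <= expected_largest_half_length R n.
Proof.
set h := (36 * r + 1)%N => le_n.
have two_gt0 : (0 < 2 ^ (40 * r))%N by rewrite expn_gt0.
have le_hn : (3200 * h <= n)%N by apply: leq_trans le_n; rewrite leq_pmulr.
have h_gt0 : (0 < h)%N by rewrite /h addn1.
set k := (n %/ h)%N; pose f := size (loop_pairs r).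
pose c i : R := (size (dycks (2 * (n - i))))%:R.
have c_gt0 i : 0 < c i by rewrite ltr0n dycks_gt0.
have le_k : (3200 * 2 ^ (40 * r) <= k)%N by rewrite leq_divRL // mulnAC.
(* Since 16^h = 16 * 2^(144 r) and f >= 2^(104 r), it suffices that k >= 200 * 16 * 2^(40 r), which
   explains 3200. Then the mean number of hits is at least 200. *)
have le_kf : (200 * 16 ^ h <= k * f)%N.
  apply: leq_trans (leq_mul le_k (size_loop_pairs r)).
  rewrite -mulnA -expnD /h expnD -[16%N]/(2 ^ 4)%N -!expnM.
  have -> : (4 * (36 * r) = 40 * r + 104 * r)%N by lia.
  by rewrite [(_ * 2 ^ (4 * 1))%N]mulnC mulnA.
have le_c0 : c 0%N <= 4 ^+ h * c h.
  rewrite /c subn0 -natrX -natrM ler_nat; have := size_dycks_le (n - h) h.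
  by rewrite subnK //; lia.
have ge_c1 : 4 ^+ h * (999 / 1000) * c (2 * h)%N <= c h.
  have := size_dycks_ge R (n - 2 * h) h.
  have -> : (n - 2 * h + h = n - h)%N by lia.
  apply: le_trans; rewrite -/(c _) ler_pM2r // ler_pM2l ?exprn_gt0 //.
  (* This makes the Bernoulli loss 3h/(2(n - 2h + 2)) at most 1/1000. *)
  have le_h : (1500 * h <= n - 2 * h)%N by lia.
  have {}le_h : 1500 * h%:R <= (n - 2 * h)%:R :> R by rewrite -natrM ler_nat.
  have h_ge0 : 0 <= h%:R :> R by [].
  suff : h%:R * (3 / (2 * ((n - 2 * h)%:R + 2))) <= 1 / 1000 :> R by lra.
  by rewrite mulrA ler_pdivrMr; lra.
have h16 : 4 ^+ h * 4 ^+ h = 16 ^+ h :> R by rewrite -exprMn; congr (_ ^+ _); ring.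
pose s := k%:R * (f%:R * c h ^+ 2).
have s_ge : 200 * c 0%N ^+ 2 <= s.
  apply: (@le_trans _ _ (200 * (4 ^+ h * c h) ^+ 2)).
    by rewrite ler_pM2l // lerXn2r ?nnegrE ?mulr_ge0 ?exprn_ge0 // ltW.
  rewrite exprMn expr2 h16 /s !mulrA ler_pM2r ?exprn_gt0 //.
  by rewrite -natrX -!natrM ler_nat leq_mul2r le_kf orbT.
have s_gt0 : 0 < s by apply: lt_le_trans s_ge; rewrite mulr_gt0 ?exprn_gt0.
have c1_ge : 999 / 1000 * (c 0%N * c (2 * h)%N) <= c h ^+ 2.
  apply: (@le_trans _ _ (999 / 1000 * (4 ^+ h * c h * c (2 * h)%N))).
    by rewrite ler_pM2l ?divr_gt0 // ler_pM2r.
  have -> : 999 / 1000 * (4 ^+ h * c h * c (2 * h)%N)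
      = c h * (4 ^+ h * (999 / 1000) * c (2 * h)%N) by ring.
  by rewrite expr2 ler_pM2l.
have := moment_ratio_ge (c_gt0 _) (c_gt0 _) (c_gt0 _) s_gt0 erefl s_ge c1_ge.
move=> /= ratio.
apply: le_trans (expected_half_length_ge (c 0%N ^+ 2 / s) (erefl h) (erefl k) (erefl s) erefl).
by rewrite mulrC -mulrA ler_pM2l ?ltr0n.
Qed.

Lemma exp4_ge r : (100 <= r)%N -> (3200 * (36 * r + 1) <= 4 ^ r)%N.
Proof.
move=> le_r; have lt_r : (r < 2 ^ r)%N by apply: ltn_expl.
(* The exponents come from 3200 <= 2^12 and 36 <= 2^6; the other factor 2^r of 4^r bounds r+1. *)
have le_18 : (2 ^ (12 + 6) <= 2 ^ r)%N by rewrite leq_exp2l //; lia.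
rewrite (_ : (4 ^ r = 2 ^ r * 2 ^ r)%N); last by rewrite -expnMn.
apply: leq_trans (leq_mul le_18 lt_r).
rewrite expnD -mulnA leq_mul //.
apply: (@leq_trans (36 * r.+1)); first by lia.
by rewrite leq_mul2r orbT.
Qed.

Lemma scaled_bound_le (R : realFieldType) (x y : R) :
  100 <= x -> y <= 42 * x + 42 ->
  8384%:R / 10000%:R * y <= 99 / 100 * (36 * x + 1).
Proof.
move=> le_x le_y.
have q_le : 8384%:R / 10000%:R <= 84 / 100 :> R.
  have -> : 10000%N = (100 * 100)%N by vm_compute.
  have : 8384%:R <= (84 * 100)%N%:R :> R by rewrite ler_nat; vm_compute.
  move: (8384%:R : R) => c; rewrite (natrM R 84 100) (natrM R 100 100) => le_c.
  by rewrite ler_pdivrMr; lra.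
have q_ge0 : 0 <= 8384%:R / 10000%:R :> R by rewrite divr_ge0.
move: (8384%:R / _) q_ge0 q_le => q q_ge0 q_le.
apply: (le_trans (ler_wpM2l q_ge0 le_y)).
(* The slopes are 35.28 and 35.64, and their difference absorbs the constants once x >= 100. *)
apply: (@le_trans _ _ (84 / 100 * (42 * x + 42))); last by lra.
by apply: ler_wpM2r => //; lra.
Qed.

Theorem theorem3p4 (R : realType) :
  exists N : nat, forall n : nat, (N <= n)%N ->
    8384%:R / 10000%:R * log2 n%:R <= expected_largest_half_length R n.
Proof.
(* The threshold makes r at least 100, as [exp4_ge] and [scaled_bound_le] require. *)
exists (2 ^ (42 * 100))%N => n le_n.
have n_gt0 : (0 < n)%N by apply: leq_trans le_n; rewrite expn_gt0.
set m := trunc_log 2 n; set r := (m %/ 42)%N.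
have [le_mn lt_nm] := andP (trunc_log_bounds (isT : 1 < 2)%N n_gt0).
have le_m : (42 * 100 <= m)%N by apply: trunc_log_max.
have le_r : (100 <= r)%N by rewrite leq_divRL // mulnC.
have le_rm : (r * 42 <= m)%N by apply: leq_trunc_div.
have lt_mr : (m.+1 <= 42 * r + 42)%N by have := ltn_ceil m (isT : 0 < 42)%N; rewrite -/r; lia.
(* Here 42 = 40 + 2: of 2^(42 r) <= n, the factor 2^(40 r) pays for the rarity of blocks and the
   remaining 4^r absorbs the linear factor. *)
have big : (3200 * (36 * r + 1) * 2 ^ (40 * r) <= n)%N.
  apply: leq_trans le_mn; apply: leq_trans (leq_pexp2l _ le_rm) => //.
  rewrite (_ : (r * 42 = 2 * r + 40 * r)%N); last by lia.
  by rewrite expnD leq_pmul2r ?expn_gt0 // expnM exp4_ge.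
apply: le_trans (expected_largest_half_length_lower R big).
have ln2_gt0 : 0 < ln 2 :> R by rewrite ln_gt0 // ltr1n.
have log_le : log2 n%:R <= m.+1%:R :> R.
  rewrite /log2 ler_pdivrMr // mulr_natl -lnXn // ler_ln ?posrE ?exprn_gt0 ?ltr0n //.
  by rewrite -natrX ler_nat ltnW.
have {}lt_mr : m.+1%:R <= 42 * r%:R + 42 :> R by rewrite -natrM -natrD ler_nat.
have {}le_r : 100 <= r%:R :> R by rewrite ler_nat.
rewrite natrD natrM; apply: scaled_bound_le => //; exact: le_trans lt_mr.
Qed.
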